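(* For all positive integers $s,t$, $\hat{p}(K_{s,t})=s\circ t$. In particular, $\hat{p}(K_{n,n})=2^{\lceil \log_2 n\rceil}$ for every positive integer $n$.
   Context: $K_{s,t}$ is the complete bipartite graph with parts of sizes $s$ and $t$. An edge-coloring assigns a color to each edge; a walk is a parity walk if every color appears an even number of times along it (with multiplicity), and it is open if its endpoints are distinct. A strong parity edge-coloring is an edge-coloring with no open parity walk, and $\hat{p}(G)$ is the minimum number of colors in such a coloring of $G$. The Hopf–Stiefel function $s\circ t$ is the least integer $N$ such that $(x+y)^N$ lies in the ideal of $\mathbb{F}_2[x,y]$ generated by $x^s$ and $y^t$; equivalently, the least $N$ such that $\binom{N}{k}$ is even whenever $N-t<k<s$. *)

(* Defs.v *)
From HB Require Import structures.
From mathcomp Require Import all_boot all_order all_algebra.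
From mathcomp Require Import mpoly boolp.

Set Implicit Arguments.
Unset Strict Implicit.
Unset Printing Implicit Defensive.

Import GRing.Theory.

Section Least.
Variables (P : nat -> Prop) (exP : exists n, P n).

Let exPb : exists n, `[< P n >].
Proof. by case: exP => n Pn; exists n; apply/asboolP. Qed.

Definition least : nat := ex_minn exPb.

Lemma leastP : P least /\ forall m, P m -> least <= m.
Proof.
rewrite /least; case: ex_minnP => n /asboolP Pn minn.
by split=> // m Pm; apply/minn/asboolP.
Qed.

End Least.

Record sgraph (T : finType) := SGraph {
  adj :> rel T;
  adj_sym : ssrbool.symmetric adj;
  adj_irrefl : irreflexive adj
}.

Section ParityColorings.
Variables (T : finType) (G : sgraph T).

Definition edges : {set {set T}} :=
  [set [set uv.1; uv.2] | uv : T * T & G uv.1 uv.2].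

(* An edge-coloring is a map on 2-element vertex sets; only its values on
   [edges] are ever used, here and in [parity_walk] below. *)
Definition ncolors (c : {set T} -> nat) : nat :=
  size (undup [seq c e | e <- enum edges]).

(* The walk with vertices x :: p, for p such that [path G x p]. *)
Definition walk_edges (x : T) (p : seq T) : seq {set T} :=
  pairmap (fun u v => [set u; v]) x p.

Definition parity_walk (c : {set T} -> nat) (x : T) (p : seq T) : Prop :=
  path G x p /\
  forall a : nat, ~~ odd (count_mem a [seq c e | e <- walk_edges x p]).

Definition open_walk (x : T) (p : seq T) : Prop := x <> last x p.

Definition strong_parity_coloring (c : {set T} -> nat) : Prop :=
  ~ exists x p, parity_walk c x p /\ open_walk x p.

Lemma odd_count_incident (v x : T) (p : seq T) : path G x p ->
  odd (count (fun e : {set T} => v \in e) (walk_edges x p))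
    = (v == x) (+) (v == last x p).
Proof.
elim: p x => [|y p IHp] x /=; first by rewrite addbb.
case/andP=> Gxy /IHp; rewrite oddD => ->.
rewrite !inE addbA; congr (_ (+) _); rewrite oddb.
case: (eqVneq v x) => [->|_] /=; last by rewrite addbb.
by case: eqVneq Gxy => [<-|]; rewrite ?adj_irrefl.
Qed.

Lemma even_count_sum (A : eqType) (a : pred A) (s : seq A) :
  (forall e, ~~ odd (count_mem e s)) -> ~~ odd (count a s).
Proof.
move=> evs; rewrite -sum1_count big_mkcond /=.
rewrite -(perm_big _ (perm_count_undup s)) /= big_flatten big_map /=.
elim: (undup s) => [|e r IHr]; first by rewrite big_nil.
rewrite big_cons oddD (negbTE IHr) addbF big_nseq iter_addn addn0 oddM.
by rewrite (negbTE (evs e)) andbF.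
Qed.

Lemma strong_parity_coloring_inj (c : {set T} -> nat) :
  injective c -> strong_parity_coloring c.
Proof.
move=> injc [x [p [[Gp evp] opn]]]; apply: opn; apply/eqP.
have ev e : ~~ odd (count_mem e (walk_edges x p)).
  have := evp (c e); rewrite count_map; congr (~~ odd _).
  by apply: eq_count => f /=; rewrite (inj_eq injc).
have := even_count_sum (fun e : {set T} => x \in e) ev.
by rewrite odd_count_incident // eqxx addTb negbK.
Qed.

Lemma strong_parity_coloring_exists :
  exists k, exists2 c, strong_parity_coloring c & ncolors c = k.
Proof.
exists (ncolors pickle); exists pickle => //.
exact/strong_parity_coloring_inj/(pcan_inj pickleK).
Qed.

Definition strong_parity_number : nat := least strong_parity_coloring_exists.

End ParityColorings.

Section CompleteBipartite.
Variables s t : nat.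

Definition Kst_adj : rel ('I_s + 'I_t) := fun u v =>
  match u, v with
  | inl _, inr _ | inr _, inl _ => true
  | _, _ => false
  end.

Lemma Kst_adj_sym : ssrbool.symmetric Kst_adj. Proof. by case=> ? []. Qed.
Lemma Kst_adj_irrefl : irreflexive Kst_adj. Proof. by case. Qed.

Definition complete_bipartite : sgraph ('I_s + 'I_t)%type :=
  SGraph Kst_adj_sym Kst_adj_irrefl.

End CompleteBipartite.

Section HopfStiefel.
Local Open Scope ring_scope.

Definition in_ideal2 (R : comNzRingType) (a b p : R) : Prop :=
  exists u v : R, p = u * a + v * b.

Definition F2x : {mpoly 'F_2[2]} := 'X_0.
Definition F2y : {mpoly 'F_2[2]} := 'X_1.

Lemma hopf_stiefel_exists (s t : nat) :
  exists N : nat, in_ideal2 (F2x ^+ s) (F2y ^+ t) ((F2x + F2y) ^+ N).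
Proof.
exists (s + t)%N; rewrite exprDn.
elim/big_ind: _ => [|p q [u [v ->]] [u' [v' ->]]|i _].
- by exists 0, 0; rewrite !mul0r addr0.
- by exists (u + u'), (v + v'); rewrite !mulrDl addrACA.
have [le_ti|lt_it] := leqP t i.
  exists 0, (F2x ^+ (s + t - i) * F2y ^+ (i - t) *+ 'C(s + t, i)).
  by rewrite mul0r add0r mulrnAl -mulrA -exprD subnK.
exists (F2x ^+ (t - i) * F2y ^+ i *+ 'C(s + t, i)), 0.
by rewrite mul0r addr0 mulrnAl mulrAC -exprD [(t - i + s)%N]addnC addnBA // ltnW.
Qed.

Definition hopf_stiefel (s t : nat) : nat := least (hopf_stiefel_exists s t).

End HopfStiefel.

(* Main.v *)
(* Lower bound.  In a strong parity coloring, the parity vectors of walks from a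
   root, taken modulo those of closed walks, label the vertices injectively by
   vectors over F_2 so that an edge uv determines f(u) + f(v) from its color.
   For K_{s,t} the sumset of the two sets of labels thus has at most as many
   elements as there are colors.  Embed the labels in the domain F_2[X]; if a set
   C contains A + B, the polynomial prod_(z in C) (x + y - z) vanishes on A x B,
   so functionals extracting the leading moments on A and on B kill the
   coefficient binom(|C|, k) of x^k y^(|C|-k) whenever k < |A| and |C|-k < |B|.
   Upper bound.  Color the edge ij by the nim-sum of i and j; by Lucas' theorem
   modulo 2 every such nim-sum is smaller than any N with (x+y)^N in (x^s, y^t). *)
Require Import Defs.
From mathcomp Require Import all_boot all_order all_algebra.
From mathcomp Require Import boolp mpoly ring zify.
From Stdlib Require PeanoNat.
Set Implicit Arguments.
Unset Strict Implicit.
Unset Printing Implicit Defensive.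
Import GRing.Theory.

(** * Sumsets and vanishing binomials over an integral domain *)

Section Sumset.
Local Open Scope ring_scope.
Variable R : idomainType.

(* The weights are a column of the adjugate of a Vandermonde matrix: using the
   adjugate rather than the inverse avoids passing to the fraction field. *)
Lemma leading_moment_functional (s : nat) (f : 'I_s -> R) (i : nat) :
  injective f -> (i < s)%N ->
  exists (w : 'I_s -> R) (d : R), d != 0 /\
    forall m, (m <= i)%N -> \sum_j w j * f j ^+ m = d *+ (m == i).
Proof.
move=> injf lt_is.
pose a : 'rV[R]_i.+1 := \row_j f (widen_ord lt_is j).
pose V := Vandermonde i.+1 a.
(* Only the first [i.+1] points carry weight; the others get 0. *)
pose w0 (j : 'I_s) : R :=
  if insub (j : nat) is Some j' then \adj V j' ord_max else 0.
exists w0, (\det V); split.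
  rewrite det_Vandermonde; apply/prodf_neq0 => j _; apply/prodf_neq0 => k lt_jk.
  rewrite subr_eq0 !mxE (inj_eq injf); apply: contraTneq lt_jk => /(congr1 val) /= ->.
  by rewrite ltnn.
move=> m le_mi; have lt_mi : (m < i.+1)%N by [].
have := congr1 (fun M : 'M_i.+1 => M (Ordinal lt_mi) ord_max) (mul_mx_adj V).
rewrite !mxE -val_eqE /= => <-.
rewrite (bigID (fun j : 'I_s => j < i.+1)%N) /= addrC big1 ?add0r => [|j]; last first.
  by move=> /negPf ltj; rewrite /w0 insubF ?mul0r.
rewrite big_ord_narrow; apply: eq_bigr => j _.
rewrite !mxE /w0 /=.
rewrite insubT // => lt_j; rewrite mulrC (_ : Sub _ _ = j) ?mxE //.
exact: val_inj.
Qed.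

(** The monic polynomial with roots [C] is summed over all [f i + g j], with weights that kill the
    powers of [f i] below [k] and of [g j] below [l]. Since [k + l] is its degree, only the top term
    of bidegree [(k, l)] survives, and both moments in it are nonzero. *)
Lemma sumset_binomial (s t : nat) (f : 'I_s -> R) (g : 'I_t -> R) (C : seq R) :
  injective f -> injective g -> (forall i j, f i + g j \in C) ->
  forall k l, (k < s)%N -> (l < t)%N -> (k + l)%N = size C -> 'C(size C, k)%:R = 0 :> R.
Proof.
move=> injf injg fgC k l lt_ks lt_lt def_kl.
have [w [d [d0 dw]]] := leading_moment_functional injf lt_ks.
have [v [e [e0 ev]]] := leading_moment_functional injg lt_lt.
pose P := \prod_(z <- C) ('X - z%:P).
have sP : size P = (size C).+1 by rewrite size_prod_XsubC.
have : \sum_i \sum_j w i * v j * P.[f i + g j] = 0.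
  rewrite big1 // => i _; rewrite big1 // => j _.
  suff /rootP-> : root P (f i + g j) by rewrite mulr0.
  by rewrite root_prod_XsubC fgC.
have -> : \sum_i \sum_j w i * v j * P.[f i + g j] =
  \sum_(n < (size C).+1) \sum_(m < n.+1) P`_n * 'C(n, m)%:R *
     ((\sum_i w i * f i ^+ (n - m)) * (\sum_j v j * g j ^+ m)).
  under eq_bigr => i _.
    under eq_bigr => j _.
      rewrite horner_coef sP mulr_sumr.
      under eq_bigr => n _ do rewrite exprDn !mulr_sumr.
      over.
    rewrite exchange_big; under eq_bigr => n _ do rewrite exchange_big.
    over.
  rewrite exchange_big; apply: eq_bigr => n _.
  rewrite exchange_big; apply: eq_bigr => m _.
  rewrite mulr_suml mulr_sumr; apply: eq_bigr => i _.
  rewrite mulr_sumr mulr_sumr; apply: eq_bigr => j _.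
  by rewrite -mulr_natr; ring.
have lt_l : (l < (size C).+1)%N by lia.
rewrite (bigD1 ord_max) //= (bigD1 (Ordinal lt_l)) //= [X in _ + X + _]big1; last first.
  move=> m; rewrite -val_eqE /= => ne_ml; case: (ltngtP m l) ne_ml => // [lt_ml|lt_lm] _.
    by rewrite ev 1?ltnW // (ltn_eqF lt_ml) mulr0n !mulr0.
  have lt_k : (size C - m < k)%N by have := ltn_ord m; lia.
  by rewrite dw 1?ltnW // (ltn_eqF lt_k) mulr0n mul0r mulr0.
rewrite addr0 [X in _ + X]big1 => [|n ne_n]; last first.
  have lt_n : (n < size C)%N.
    have := ltn_ord n; rewrite ltnS leq_eqVlt => /predU1P[def_n|//].
    by case/eqP: ne_n; apply: val_inj.
  rewrite big1 // => m _; case: (ltnP m l) => [lt_ml|le_lm].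
    by rewrite ev 1?ltnW // (ltn_eqF lt_ml) mulr0n !mulr0.
  have lt_k : (n - m < k)%N by have := ltn_ord m; lia.
  by rewrite dw 1?ltnW // (ltn_eqF lt_k) mulr0n mul0r mulr0.
rewrite addr0 (_ : (size C - l)%N = k) ?dw ?ev // ?eqxx; last by lia.
have -> : P`_(size C) = 1.
  by have /monicP := monic_prod_XsubC C xpredT id; rewrite lead_coefE sP.
move/eqP; rewrite mul1r !mulf_eq0 (negPf d0) (negPf e0) !orbF => /eqP <-.
by rewrite (_ : k = size C - l)%N ?bin_sub //; lia.
Qed.
End Sumset.

(** * Vertex labels from walks in a strong parity coloring *)

Section Labelling.
Local Open Scope ring_scope.
Variables (T : finType) (G : sgraph T) (c : {set T} -> nat).
Hypothesis strongc : strong_parity_coloring G c.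
Hypothesis connG : forall x y, connect G x y.

Let D := undup [seq c e | e <- enum (edges G)].
Let n := size D.

(** Coordinates are indexed by the colors that occur on edges; any other color gets the zero
    vector. *)
Definition color_vec (a : nat) : 'rV['F_2]_n := \row_i (nth 0%N D i == a)%:R.

Definition walk_vec (x : T) (p : seq T) := \sum_(e <- walk_edges x p) color_vec (c e).

Lemma natr_F2_eq0 m : (m%:R == 0 :> 'F_2) = ~~ odd m.
Proof. by rewrite -val_eqE /= val_Fp_nat // modn2; case: odd. Qed.

Lemma row_F2_addvv (v : 'rV['F_2]_n) : v + v = 0.
Proof. by rewrite -mulr2n -scaler_nat pchar_Fp_0 // scale0r. Qed.

Lemma walk_edges_sub x p : path G x p -> {subset walk_edges x p <= edges G}.
Proof.
elim: p x => //= y p IHp x /andP[Gxy Gp] e; rewrite inE => /predU1P[->|]; last exact: IHp.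
by apply/imsetP; exists (x, y); rewrite ?inE.
Qed.

Lemma walk_vec_eq0 x p : path G x p -> walk_vec x p = 0 -> parity_walk G c x p.
Proof.
move=> Gp vec0; split=> // a; case: (boolP (a \in D)) => [/(nthP 0%N)[i lt_i <-]|aD].
  have := congr1 (fun v : 'rV_n => v 0 (Ordinal lt_i)) vec0.
  rewrite summxE mxE; under eq_bigr do rewrite mxE.
  move=> /eqP; rewrite -natr_sum natr_F2_eq0; congr (~~ odd _).
  rewrite count_map -sum1_count [RHS]big_mkcond /=; apply: eq_bigr => e _.
  by rewrite eq_sym; case: eqP.
suff /count_memPn-> : a \notin [seq c e | e <- walk_edges x p] by [].
apply: contra aD => /mapP[e /(walk_edges_sub Gp) eG ->].
by rewrite mem_undup map_f // mem_enum.
Qed.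


Definition joins (x y : T) (v : 'rV['F_2]_n) :=
  exists2 p, path G x p & last x p = y /\ walk_vec x p = v.

Lemma joins_nil x : joins x x 0.
Proof. by exists [::]; split=> //; rewrite /walk_vec /= big_nil. Qed.

Lemma joins_edge x y : G x y -> joins x y (color_vec (c [set x; y])).
Proof.
by exists [:: y]; rewrite /= ?andbT //; split=> //; rewrite /walk_vec /= big_seq1.
Qed.

Lemma joins_cat x y z u v : joins x y u -> joins y z v -> joins x z (u + v).
Proof.
case=> p Gp [<- <-] [q Gq [<- <-]]; exists (p ++ q); rewrite ?cat_path ?Gp //.
by rewrite last_cat /walk_vec /walk_edges pairmap_cat big_cat.
Qed.

Lemma joins_sym x y v : joins x y v -> joins y x v.
Proof.
case=> p; elim: p x v => [|z p IHp] x v /=.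
  by move=> _ [<- <-]; rewrite /walk_vec /= big_nil; apply: joins_nil.
case/andP=> Gxz Gp [lastp <-]; rewrite /walk_vec /= big_cons addrC.
apply: joins_cat (IHp _ _ Gp (conj lastp erefl)) _.
by rewrite setUC; apply: joins_edge; rewrite adj_sym.
Qed.

Lemma joins0_eq x y : joins x y 0 -> x = y.
Proof.
case=> p Gp [<- /walk_vec_eq0 vec0]; apply: contrapT => opn; apply: strongc.
by exists x, p; split; first exact: vec0.
Qed.

Lemma joins_connected x y : exists v, joins x y v.
Proof. by have /connectP[p Gp ->] := connG x y; exists (walk_vec x p), p. Qed.

Definition closed_walk_space (x0 : T) : 'M['F_2]_n :=
  (\sum_(v : 'rV['F_2]_n | `[< joins x0 x0 v >]) <<v>>)%MS.

(** Concatenation makes the vectors of closed walks stable under sums, and the only scalars are 0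
    and 1, so taking the span adds nothing. *)
Lemma closed_walk_spaceP x0 v :
  v *m cokermx (closed_walk_space x0) = 0 <-> joins x0 x0 v.
Proof.
split=> [/eqP|clv]; last first.
  apply/eqP; rewrite -submxE; apply: (sumsmx_sup v); first exact/asboolP.
  by rewrite genmxE.
rewrite -submxE => /sub_sumsmxP[u ->].
elim/big_ind: _ => [|v1 v2|w /asboolP clw]; [exact: joins_nil|exact: joins_cat|].
have /sub_rVP[a ->] : (u w *m <<w>> <= w)%MS.
  by rewrite (submx_trans (submxMl _ _)) ?genmxE.
have [->|->] : a = 0 \/ a = 1.
- by case: a => -[|[|//]] ?; [left | right]; apply: val_inj.
- by rewrite scale0r; apply: joins_nil.
by rewrite scale1r.
Qed.

(* Potentials are taken in the space of color vectors modulo those of the closed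
   walks; there a walk of trivial parity vector lifts to a parity walk. *)
Lemma strong_parity_labelling :
  exists (f : T -> {poly 'F_2}) (g : nat -> {poly 'F_2}), injective f /\
    forall x y, G x y -> f x + f y = g (c [set x; y]).
Proof.
have [[x0]|noT] := pselect (inhabited T); last first.
  by exists (fun=> 0), (fun=> 0); split=> x; case: noT.
have [f0 f0P] := choice (joins_connected x0).
(* The quotient map is [cokermx]; [rVpoly] then embeds its image in an integral domain, as the
   sumset argument requires. *)
pose h (v : 'rV['F_2]_n) := rVpoly (v *m cokermx (closed_walk_space x0)).
have hD u v : h (u + v) = h u + h v by rewrite /h mulmxDl raddfD.
have h0 v : h v = 0 -> joins x0 x0 v.
  by move/(congr1 (@poly_rV _ n)); rewrite rVpolyK raddf0 => /closed_walk_spaceP.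
have hN v : - h v = h v.
  by apply/eqP; rewrite eq_sym -addr_eq0 -hD row_F2_addvv /h mul0mx raddf0.
exists (h \o f0), (h \o color_vec); split=> [x y /eqP | x y Gxy] /=.
  rewrite -subr_eq0 hN -hD => /eqP/h0 cl; apply: joins0_eq.
  (* Going from [x] to [x0], around the closed walk and on to [y] uses each of [f0 x] and [f0 y]
     twice. *)
  have := joins_cat (joins_sym (f0P x)) (joins_cat cl (f0P y)).
  by rewrite addrA addrA row_F2_addvv add0r row_F2_addvv.
apply/eqP; rewrite -subr_eq0 hN -!hD; apply/eqP.
have /closed_walk_spaceP clv : joins x0 x0 (f0 x + f0 y + color_vec (c [set x; y])).
  rewrite addrAC; apply: joins_cat (joins_sym (f0P y)).
  by apply: joins_cat (f0P x) _; apply: joins_edge.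
by rewrite /h clv raddf0.
Qed.
End Labelling.

(** * Nim-sums and binomial coefficients modulo 2 *)

Section Nim.
Lemma lxor_double (a b : nat) (x y : bool) :
  PeanoNat.Nat.lxor (a.*2 + x) (b.*2 + y) = (PeanoNat.Nat.lxor a b).*2 + (x (+) y).
Proof.
have dblE m (z : bool) : m.*2 + z = (2 * m + PeanoNat.Nat.b2n z)%coq_nat by case: z; lia.
rewrite !dblE; apply: PeanoNat.Nat.bits_inj => -[|p];
  rewrite PeanoNat.Nat.lxor_spec.
  by rewrite !PeanoNat.Nat.testbit_0_r; case: x; case: y.
by rewrite !PeanoNat.Nat.testbit_succ_r PeanoNat.Nat.lxor_spec.
Qed.

(** Lucas' theorem modulo 2 for the last binary digit. Pascal's rule leads from row [n.*2] to the
    next row, and from there to row [n.+1.*2]. *)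
Lemma odd_bin_double n k :
  [/\ odd 'C(n.*2, k.*2) = odd 'C(n, k), odd 'C(n.*2, k.*2.+1) = false,
      odd 'C(n.*2.+1, k.*2) = odd 'C(n, k)
    & odd 'C(n.*2.+1, k.*2.+1) = odd 'C(n, k)].
Proof.
have step m : (forall i, odd 'C(m.*2, i.*2) = odd 'C(m, i)) ->
    (forall i, odd 'C(m.*2, i.*2.+1) = false) ->
    forall i, odd 'C(m.*2.+1, i.*2) = odd 'C(m, i) /\
              odd 'C(m.*2.+1, i.*2.+1) = odd 'C(m, i).
  move=> ev od i; rewrite binS oddD od ev; split=> //.
  by case: i => [|i]; rewrite ?bin0 // doubleS binS oddD -doubleS ev od addbF.
suff [ev od] : (forall i, odd 'C(n.*2, i.*2) = odd 'C(n, i)) /\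
               (forall i, odd 'C(n.*2, i.*2.+1) = false).
  by have [? ?] := step n ev od k; split.
elim: n => [|n [ev od]]; first by split=> [[]|].
have S := step n ev od; split=> i; rewrite doubleS.
  case: i => [|i]; rewrite ?bin0 //.
  by rewrite doubleS binS oddD -doubleS (S _).1 (S _).2 -oddD -binS.
by rewrite binS oddD (S i).1 (S i).2 addbb.
Qed.

Lemma odd_bin_double_add n k (x y : bool) : y <= x ->
  odd 'C(n.*2 + x, k.*2 + y) = odd 'C(n, k).
Proof.
have [] := odd_bin_double n k.
by case: x y => [] [] //; rewrite ?addn0 ?addn1.
Qed.

(* Above the highest bit where [PeanoNat.Nat.lxor i j] and [N] differ, each bit of [N] is
   set in exactly one of [i] and [j], and goes to [k] or [l] accordingly; the
   lower bits of [N] all go to the side that became strictly smaller there. *)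
Lemma odd_bin_lxor N i j : N <= PeanoNat.Nat.lxor i j ->
  exists k l, [/\ k + l = N, k <= i, l <= j, odd 'C(N, k)
    & N < PeanoNat.Nat.lxor i j -> k < i \/ l < j].
Proof.
have [m] : exists m, N + i + j < m by exists (N + i + j).+1.
elim: m N i j => // m IHm N i j lt_m le_N.
have [z|nz] := posnP (N + i + j).
  by exists 0, 0; move: z le_N {lt_m}; case: N i j => // -[|//] [].
pose N' := N./2; pose i' := i./2; pose j' := j./2.
have dN := odd_double_half N; have di := odd_double_half i; have dj := odd_double_half j.
have lE : PeanoNat.Nat.lxor i j = (PeanoNat.Nat.lxor i' j').*2 + (odd i (+) odd j).
  by rewrite -{1}di -{1}dj ![odd _ + _]addnC lxor_double.
have le_N' : N' <= PeanoNat.Nat.lxor i' j' by move: le_N; rewrite /N' lE; lia.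
have [] := IHm N' i' j' _ le_N'; first by rewrite /N' /i' /j'; lia.
move=> k [l [dkl le_k le_l Ck lt_kl]].
(* Here [x] and [y] are the lowest bits appended to [k] and [l]; they share out the lowest bit of
   [N] without a carry. *)
have mk (x y : bool) : x + y = odd N -> k.*2 + x <= i -> l.*2 + y <= j ->
   (N < PeanoNat.Nat.lxor i j -> k.*2 + x < i \/ l.*2 + y < j) -> 
   exists k l, [/\ k + l = N, k <= i, l <= j, odd 'C(N, k) & N < PeanoNat.Nat.lxor i j -> k < i \/ l < j].
  move=> xy lek lel lts; exists (k.*2 + x), (l.*2 + y); split=> //; first by lia.
  by rewrite -dN addnC odd_bin_double_add //; lia.
(* A side that is already strictly smaller can take the lowest bit of [N]. *)
have [lt_N'|ge_N'] := ltnP N' (PeanoNat.Nat.lxor i' j').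
  have [lt_k|lt_l] := lt_kl lt_N'.
    by apply: (mk (odd N) false); lia.
  by apply: (mk false (odd N)); lia.
move: le_N; rewrite {}lE in mk *.
case oN: (odd N) in mk dN *; case oi: (odd i) in di mk *;
  case oj: (odd j) in dj mk * => /= le_N.
all: by [apply: (mk false false) => /=; lia | apply: (mk true false) => /=; lia
        | apply: (mk false true) => /=; lia].
Qed.

Lemma lxor_pow2 m : PeanoNat.Nat.lxor (2 ^ m) (2 ^ m).-1 = (2 ^ m.+1).-1.
Proof.
elim: m => // m IHm.
have := lxor_double (2 ^ m) (2 ^ m).-1 false true.
rewrite IHm addn0 !addn1 => lE; have := expn_gt0 2 m => /= pos.
have -> : 2 ^ m.+1 = (2 ^ m).*2 by rewrite expnS mul2n.
rewrite (_ : (2 ^ m).*2.-1 = (2 ^ m).-1.*2.+1) ?lE ?expnS; lia.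
Qed.

(** The Frobenius identity modulo 2, read on coefficients. *)
Lemma odd_bin_pow2 m k : 0 < k < 2 ^ m -> odd 'C(2 ^ m, k) = false.
Proof.
elim: m k => [|m IHm] k; first by case: k => // -[].
rewrite expnS mul2n -(odd_double_half k).
have [ev od _ _] := odd_bin_double (2 ^ m) k./2.
by case: odd => /= lt_k; rewrite ?add1n ?od // add0n ev IHm //; lia.
Qed.

End Nim.

(** * The Hopf-Stiefel function in terms of binomials *)

Section HopfStiefelBinomial.
Variables s t : nat.

(** The condition [N - t < k < s], with [l] standing for [N - k] to avoid truncated subtraction. *)
Definition even_binomials (N : nat) : Prop :=
  forall k l, k < s -> l < t -> k + l = N -> ~~ odd 'C(N, k).

Lemma lxor_lt_even_binomials N i j :
  even_binomials N -> i < s -> j < t -> PeanoNat.Nat.lxor i j < N.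
Proof.
move=> evN lt_is lt_jt; rewrite ltnNge; apply/negP => /odd_bin_lxor[k [l [dN le_k le_l Ck _]]].
by have /negP := evN k l (leq_ltn_trans le_k lt_is) (leq_ltn_trans le_l lt_jt) dN.
Qed.

Local Open Scope ring_scope.

Lemma ideal_even_binomials N :
  in_ideal2 (F2x ^+ s) (F2y ^+ t) ((F2x + F2y) ^+ N) -> even_binomials N.
Proof.
move=> [u [v]].
(* In iterated polynomials, x outside and y inside, the coefficient of x^k y^l is read off as
   [p]_k[_l]. *)
pose h (i : 'I_2) : {poly {poly 'F_2}} := if i == 0 then 'X else 'X%:P.
pose phi : {rmorphism {mpoly 'F_2[2]} -> {poly {poly 'F_2}}} := mmap (polyC \o polyC) h.
have phix : phi F2x = 'X by rewrite /phi /= mmapX mmap1U.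
have phiy : phi F2y = 'X%:P by rewrite /phi /= mmapX mmap1U.
move/(congr1 phi); rewrite rmorphD !rmorphM !rmorphXn rmorphD phix phiy.
move=> E k l lt_ks lt_lt dN; rewrite -natr_F2_eq0; apply/eqP.
have := congr1 (fun p : {poly {poly 'F_2}} => p`_k`_l) E.
rewrite coefD coefMXn lt_ks add0r -polyC_exp coefMC coefMXn lt_lt => <-.
rewrite addrC exprDn !coef_sum.
have lt_k : (k < N.+1)%N by lia.
rewrite (bigD1 (Ordinal lt_k)) //= big1 => [|i]; last first.
  rewrite -val_eqE /= eq_sym => /negPf ne_ik.
  by rewrite coefMn -polyC_exp coefCM coefXn ne_ik mulr0 mul0rn coef0.
rewrite addr0 coefMn -polyC_exp coefCM coefXn eqxx mulr1 coefMn coefXn.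
by rewrite (_ : (N - k)%N = l) ?eqxx //; lia.
Qed.

Lemma even_binomials_ideal N :
  even_binomials N -> in_ideal2 (F2x ^+ s) (F2y ^+ t) ((F2x + F2y) ^+ N).
Proof.
move=> evN; rewrite exprDn.
elim/big_ind: _ => [|p q [u [v ->]] [u' [v' ->]]|i _].
- by exists 0, 0; rewrite !mul0r addr0.
- by exists (u + u'), (v + v'); rewrite !mulrDl addrACA.
(* Each term is a multiple of y^t, a multiple of x^s, or has an even coefficient. *)
have [le_ti|lt_it] := leqP t i.
  exists 0, (F2x ^+ (N - i) * F2y ^+ (i - t) *+ 'C(N, i)).
  by rewrite mul0r add0r mulrnAl -mulrA -exprD subnK.
have [le_si|lt_is] := leqP s (N - i).
  exists (F2x ^+ (N - i - s) * F2y ^+ i *+ 'C(N, i)), 0.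
  by rewrite mul0r addr0 mulrnAl mulrAC -exprD subnK.
have le_iN : (i <= N)%N by rewrite -ltnS.
have := evN _ _ lt_is lt_it (subnK le_iN); rewrite bin_sub // -natr_F2_eq0 => /eqP C0.
exists 0, 0; rewrite !mul0r addr0 -mulr_natr -(rmorph_nat (@mpolyC 2 'F_2)) C0.
by rewrite rmorph0 mulr0.
Qed.

Lemma hopf_stiefel_even_binomials : even_binomials (hopf_stiefel s t).
Proof. exact: ideal_even_binomials (leastP (hopf_stiefel_exists s t)).1. Qed.

Lemma hopf_stiefel_le N : even_binomials N -> (hopf_stiefel s t <= N)%N.
Proof. by move/even_binomials_ideal; apply: (leastP (hopf_stiefel_exists s t)).2. Qed.

End HopfStiefelBinomial.

Lemma hopf_stiefel_diag n : 0 < n -> hopf_stiefel n n = 2 ^ up_log 2 n.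
Proof.
move=> n0; apply/eqP; rewrite eqn_leq; apply/andP; split.
  apply: hopf_stiefel_le => k l lt_k lt_l dkl; have := up_logP n (isT : 1 < 2) => le_n.
  by rewrite odd_bin_pow2 //; lia.
have ev := @hopf_stiefel_even_binomials n n.
have [n1|n_gt1] := leqP n 1.
  have def_n : n = 1 by lia.
  by rewrite [X in 2 ^ up_log 2 X]def_n up_log1; have := lxor_lt_even_binomials ev n0 n0.
(* With m = [up_log 2 n], both 2^(m-1) and 2^(m-1) - 1 are below [n], and their nim-sum 2^m - 1 must
   be below the Hopf-Stiefel value. *)
have /andP[lt_n _] := up_log_bounds (isT : 1 < 2) n_gt1.
have lt_n' := leq_ltn_trans (leq_pred _) lt_n.
have := lxor_lt_even_binomials ev lt_n lt_n'.
have m0 : 0 < up_log 2 n by rewrite up_log_gt0.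
by rewrite lxor_pow2 prednK // prednK // expn_gt0.
Qed.

(** * Cuts crossed evenly by parity walks *)

Section XorColoring.
Variables (T : finType) (G : sgraph T) (c : {set T} -> nat).

Lemma odd_count_telescope (h : T -> bool) (a : pred nat) x p :
    (forall u v, G u v -> a (c [set u; v]) = h u (+) h v) -> path G x p ->
  odd (count a [seq c e | e <- walk_edges x p]) = h x (+) h (last x p).
Proof.
move=> ah; elim: p x => [|y p IHp] x /=; first by rewrite addbb.
case/andP=> Gxy /IHp; rewrite oddD => ->; rewrite ah // oddb.
by rewrite addbA addbK.
Qed.

(** The cut defined by [h] is a union of color classes, so a parity walk crosses it an even number
    of times. *)
Lemma parity_walk_invariant (h : T -> bool) (a : pred nat) x p :
    (forall u v, G u v -> a (c [set u; v]) = h u (+) h v) ->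
  parity_walk G c x p -> h x = h (last x p).
Proof.
move=> ah [Gp /(even_count_sum a)]; rewrite (odd_count_telescope ah Gp).
by case: (h x); case: (h _).
Qed.

Lemma ncolors_le N : (forall e, e \in edges G -> c e < N) -> ncolors G c <= N.
Proof.
move=> ltN; rewrite -(size_iota 0 N); apply: uniq_leq_size (undup_uniq _) _ => a.
rewrite mem_undup => /mapP[e]; rewrite mem_enum => /ltN ? ->.
by rewrite mem_iota.
Qed.

End XorColoring.

(** * Both bounds for complete bipartite graphs *)

Section BipartiteColoring.
Variables s t : nat.

(** Edges are unordered pairs, so [pick] recovers the two ends; 0 is a default for non-edges. *)
Definition lxor_coloring (e : {set 'I_s + 'I_t}) : nat :=
  if [pick uv : 'I_s * 'I_t | e == [set inl uv.1; inr uv.2]] is Some uv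
  then PeanoNat.Nat.lxor uv.1 uv.2 else 0.

Lemma lxor_coloringE (i : 'I_s) (j : 'I_t) :
  lxor_coloring [set inl i; inr j] = PeanoNat.Nat.lxor i j.
Proof.
rewrite /lxor_coloring; case: pickP => [[i' j'] /= /eqP E | /(_ (i, j))].
  have /set2P[[->]|//] : inl i \in [set inl i'; inr j'] by rewrite -E set21.
  by have /set2P[|[->]] : inr j \in [set inl i'; inr j'] by rewrite -E set22.
by rewrite eqxx.
Qed.

Definition part_index (v : 'I_s + 'I_t) : nat :=
  match v with inl i => i | inr j => j end.

Lemma lxor_coloring_adj u v : complete_bipartite s t u v ->
  lxor_coloring [set u; v] = PeanoNat.Nat.lxor (part_index u) (part_index v).
Proof.
case: u v => [i|j] [i'|j'] //= _; first exact: lxor_coloringE.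
by rewrite setUC lxor_coloringE PeanoNat.Nat.lxor_comm.
Qed.

(* A parity walk has even length, so its ends lie on the same side, where the
   indices determine the vertices. *)
Lemma lxor_coloring_strong : strong_parity_coloring (complete_bipartite s t) lxor_coloring.
Proof.
move=> [x [p [pw]]]; apply.
have side : is_inl x = is_inl (last x p).
  by apply: (parity_walk_invariant (a := predT)) pw => -[?|?] [].
have idx : part_index x = part_index (last x p).
  apply: PeanoNat.Nat.bits_inj => q.
  (* Each bit of the index defines a cut that the same bit of the color detects. *)
  apply: (parity_walk_invariant (h := fun v => PeanoNat.Nat.testbit (part_index v) q)
     (a := PeanoNat.Nat.testbit^~ q)) pw => u v Guv.
  by rewrite lxor_coloring_adj // PeanoNat.Nat.lxor_spec; do 2!case: PeanoNat.Nat.testbit.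
by move: (last x p) side idx {pw} => y; case: x y => [i|j] [i'|j'] //= _ /val_inj->.
Qed.

Lemma lxor_ncolors N : even_binomials s t N ->
  ncolors (complete_bipartite s t) lxor_coloring <= N.
Proof.
move=> evN; apply: ncolors_le => e /imsetP[[u v]]; rewrite inE /= => Guv ->.
rewrite lxor_coloring_adj //.
case: u v Guv => [i|j] [i'|j'] //= _; last rewrite PeanoNat.Nat.lxor_comm.
  exact: (lxor_lt_even_binomials evN).
exact: (lxor_lt_even_binomials evN).
Qed.

Lemma connect_complete_bipartite : 0 < s -> 0 < t ->
  forall u v, connect (complete_bipartite s t) u v.
Proof.
move=> s0 t0.
have cr i j : connect (complete_bipartite s t) (inl i) (inr j) by apply: connect1.
have cl i j : connect (complete_bipartite s t) (inr j) (inl i) by apply: connect1.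
case=> [i|j] [i'|j'] //.
  exact: connect_trans (cr i (Ordinal t0)) (cl _ _).
exact: connect_trans (cl (Ordinal s0) j) (cr _ _).
Qed.

Lemma ncolors_even_binomials c : 0 < s -> 0 < t ->
  strong_parity_coloring (complete_bipartite s t) c ->
  even_binomials s t (ncolors (complete_bipartite s t) c).
Proof.
move=> s0 t0 strongc.
have [f [g [injf fg]]] := strong_parity_labelling strongc (connect_complete_bipartite s0 t0).
(* Colors may share a value of [g]; repetitions are kept so that the size is exactly the number of
   colors. *)
pose C := [seq g a | a <- undup [seq c e | e <- enum (edges (complete_bipartite s t))]].
have sC : size C = ncolors (complete_bipartite s t) c by rewrite size_map.
have fC i j : (f (inl i) + f (inr j))%R \in C.
  rewrite (fg (inl i) (inr j)) // map_f // mem_undup map_f // mem_enum.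
  by apply/imsetP; exists (inl i, inr j); rewrite ?inE.
move=> k l lt_k lt_l; rewrite -sC => dkl.
have injl : injective (f \o inl) by move=> ? ? /injf [].
have injr : injective (f \o inr) by move=> ? ? /injf [].
have /eqP := sumset_binomial injl injr fC lt_k lt_l dkl.
by rewrite -(rmorph_nat polyC) polyC_eq0 natr_F2_eq0.
Qed.

End BipartiteColoring.

Theorem theorem1p9 :
  (forall s t : nat, 0 < s -> 0 < t ->
     strong_parity_number (complete_bipartite s t) = hopf_stiefel s t) /\
  (forall n : nat, 0 < n ->
     strong_parity_number (complete_bipartite n n) = 2 ^ up_log 2 n).
Proof.
have main s t : 0 < s -> 0 < t ->
    strong_parity_number (complete_bipartite s t) = hopf_stiefel s t.
  move=> s0 t0.
  have [[c strongc dc] minc] := leastP (strong_parity_coloring_exists (complete_bipartite s t)).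
  apply/eqP; rewrite eqn_leq; apply/andP; split; last first.
    apply: hopf_stiefel_le; rewrite /strong_parity_number -dc.
    exact: ncolors_even_binomials.
  apply: leq_trans (lxor_ncolors (@hopf_stiefel_even_binomials s t)).
  by apply: minc; exists (@lxor_coloring s t); first exact: lxor_coloring_strong.
by split=> // n n0; rewrite main // hopf_stiefel_diag.
Qed.
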